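(* Let $G$ be a connected subcubic graph that is distinct from (i.e. not isomorphic to) $K_{3,3}$. Let $m$ be the number of edges of $G$ and let $b$ be the number of good bridges of $G$. Then $$\nu_{ur}(G)\geq \frac{m+b}{6}.$$
   Context: All graphs are simple, finite, and undirected. A graph is subcubic if every vertex has degree at most $3$. A matching $M$ in a graph $G$ is uniquely restricted if no other matching in $G$ covers the same set of vertices as $M$. The uniquely restricted matching number $\nu_{ur}(G)$ is the maximum size (number of edges) of a uniquely restricted matching in $G$. A bridge in a graph $G$ (an edge that lies on no cycle) is called good if it lies on a path in $G$ between two vertices that each have degree at most $2$ in $G$. *)

(* Defs.v *)
(* MathComp world. A simple finite graph is a finType T of vertices together
   with an adjacency relation e : rel T; the hypotheses [symmetric e] and
   [irreflexive e] are left to the statements that need them. *)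
From mathcomp Require Import all_boot all_order all_algebra.
From mathcomp Require Import boolp.

Set Implicit Arguments.
Unset Strict Implicit.
Unset Printing Implicit Defensive.

Section Graph.

Variables (T : finType) (e : rel T).

Definition degree (x : T) : nat := #|[set y | e x y]|.

Definition subcubic : Prop := forall x, degree x <= 3.

(* The graph without vertices counts as connected. *)
Definition connected_graph : Prop := forall x y, connect e x y.

Definition edges : {set {set T}} := [set [set x; y] | x in T, y in T & e x y].

(* Edges are nonempty, so [trivIset M] says that distinct edges of M are
   disjoint, and [cover M] is the set of vertices covered by M. *)
Definition matching (M : {set {set T}}) : bool :=
  (M \subset edges) && trivIset M.

Definition uniquely_restricted (M : {set {set T}}) : bool :=
  matching M &&
  [forall M' : {set {set T}},
     matching M' && (cover M' == cover M) ==> (M' == M)].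

Definition nu_ur : nat :=
  \max_(M : {set {set T}} | uniquely_restricted M) #|M|.

(* The edges joining consecutive vertices of the walk x :: p. *)
Definition walk_edges (x : T) (p : seq T) : seq {set T} :=
  pairmap (fun u v => [set u; v]) x p.

Definition on_cycle (F : {set T}) : Prop :=
  exists x p, [/\ ucycle e (x :: p), 3 <= size (x :: p)
                & F \in walk_edges x (rcons p x)].

Definition bridge (F : {set T}) : Prop := F \in edges /\ ~ on_cycle F.

(* Both ends are distinct, since the path is simple and contains the edge F. *)
Definition good_bridge (F : {set T}) : Prop :=
  bridge F /\
  exists x p, [/\ path e x p, uniq (x :: p), F \in walk_edges x p,
                  degree x <= 2 & degree (last x p) <= 2].

Definition good_bridges : {set {set T}} := [set F | `[< good_bridge F >]].

End Graph.

Definition isomorphic (T1 T2 : finType) (e1 : rel T1) (e2 : rel T2) : Prop :=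
  exists f : T1 -> T2, bijective f /\ forall x y, e2 (f x) (f y) = e1 x y.

Definition K33 : rel (bool * 'I_3) := fun u v => u.1 != v.1.

(* Main.v *)
Require Import Defs.
From mathcomp Require Import all_boot all_order all_algebra zify.
From mathcomp Require Import boolp.

(** Suppose first that the graph is not cubic. The proof is a greedy one: pick a
    vertex [u] of degree at most 2, match it to a neighbour, and delete [u] with
    all of its neighbours. No other matching covering the same vertices can
    match [u] differently ([nu_closed_nbrs]), and at most 6 edges disappear,
    namely those at the at most two neighbours of [u]. Every component of what
    remains again has a vertex of degree at most 2, because it has lost an edge
    or was a component before. This gives m / 6 by induction.

    Good bridges survive deletions ([separating_delete]), so they only have to
    be paid for when they are destroyed. If the deletion meets one, a cheaper
    step is available at the end of the tree formed by the good bridges: a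
    bridge lies on no alternating cycle, hence it can be matched while
    only its two ends are deleted ([nu_bridge]). Together this gives
    [deficient_bound], the bound for all graphs without cubic components.

    A connected cubic graph has no good bridge. The first deletion now destroys
    9 edges, 3 more than allowed, but since the number of edges is divisible by
    3 it is enough to save one edge somewhere. This fails only for K_{3,3}
    ([cubic_bound]): either a triangle or a pair of vertices with exactly two
    common neighbours produces the saving, or there are no 4-cycles, in
    which case the last step of the greedy procedure saves an edge
    ([C4_free_bound]). *)

Set Implicit Arguments.
Unset Strict Implicit.
Unset Printing Implicit Defensive.

(** * Neighbourhoods, deletions and sides of an edge *)

Definition nbrs (T : finType) (r : rel T) (x : T) : {set T} := [set y | r x y].
Definition closed_nbrs (T : finType) (r : rel T) (x : T) : {set T} :=
  x |: nbrs r x.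
Definition star (T : finType) (r : rel T) (x : T) : {set {set T}} :=
  [set [set x; y] | y in nbrs r x].
(** Deleted vertices stay in the type as isolated vertices: all graphs of an
    induction live on one vertex type, and a deleted vertex forms a component
    that does contain a vertex of degree at most 2. *)
Definition delete (T : finType) (r : rel T) (D : {set T}) : rel T :=
  fun x y => [&& r x y, x \notin D & y \notin D].
Definition cut (T : finType) (r : rel T) (x y : T) : rel T :=
  fun a b => r a b && ([set a; b] != [set x; y]).
(** The component of [x] once the edge [xy] is removed; [xy] is a bridge
    exactly when [y] is outside of it. *)
Definition side (T : finType) (r : rel T) (x y : T) : {set T} :=
  [set z | connect (cut r x y) x z].

Lemma set2_eq (T : finType) (a b x y : T) :
  [set a; b] = [set x; y] -> (a = x /\ b = y) \/ (a = y /\ b = x).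
Proof.
move=> E.
have: a \in [set x; y] by rewrite -E set21.
have: b \in [set x; y] by rewrite -E set22.
have: x \in [set a; b] by rewrite E set21.
have: y \in [set a; b] by rewrite E set22.
by rewrite !inE; do 4![case/orP=> /eqP ?]; subst; tauto.
Qed.

Lemma edgeP (T : finType) (r : rel T) (F : {set T}) :
  reflect (exists x y, r x y /\ F = [set x; y]) (F \in edges r).
Proof.
apply: (iffP imset2P) => [[x y _]|[x [y [rxy ->]]]].
  by rewrite inE => /andP[_ rxy] ->; exists x, y.
by exists x y => //; rewrite inE.
Qed.

Lemma edge_mem (T : finType) (r : rel T) x y : r x y -> [set x; y] \in edges r.
Proof. by move=> rxy; apply/edgeP; exists x, y. Qed.

Lemma star_mem (T : finType) (r : rel T) x y : r x y -> [set x; y] \in star r x.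
Proof. by move=> rxy; apply/imset_f; rewrite inE. Qed.

Lemma card_star (T : finType) (r : rel T) x : #|star r x| <= degree r x.
Proof. exact: leq_imset_card. Qed.

Lemma delete_sym (T : finType) (r : rel T) D :
  symmetric r -> symmetric (delete r D).
Proof. by move=> rs x y; rewrite /delete rs andbA andbAC -andbA. Qed.

Lemma delete_irr (T : finType) (r : rel T) D :
  irreflexive r -> irreflexive (delete r D).
Proof. by move=> ri x; rewrite /delete ri. Qed.

Lemma deleteW (T : finType) (r : rel T) D : subrel (delete r D) r.
Proof. by move=> x y /and3P[]. Qed.

Lemma delete_delete (T : finType) (r : rel T) D1 D2 :
  delete (delete r D1) D2 = delete r (D1 :|: D2).
Proof.
apply/funext=> x; apply/funext=> y; rewrite /delete !inE !negb_or.
by case: (r x y) (x \in D1) (y \in D1) (x \in D2) (y \in D2)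
  => [] [] [] [] [].
Qed.

Lemma cutC (T : finType) (r : rel T) x y : cut r x y = cut r y x.
Proof. by rewrite /cut setUC. Qed.

Lemma cut_sym (T : finType) (r : rel T) x y : symmetric r -> symmetric (cut r x y).
Proof. by move=> rs a b; rewrite /cut rs setUC. Qed.

Lemma degree_sub (T : finType) (r r' : rel T) x :
  subrel r' r -> degree r' x <= degree r x.
Proof. by move=> sub; apply/subset_leq_card/subsetP=> y; rewrite !inE; apply: sub. Qed.

Lemma trivIset_meet (T : finType) (N : {set {set T}}) F G x :
  trivIset N -> F \in N -> G \in N -> x \in F -> x \in G -> F = G.
Proof.
move=> tN FN GN xF xG; apply/eqP; apply: contraT => nFG.
have /trivIsetP/(_ _ _ FN GN nFG)/pred0P/(_ x) /= := tN.
by rewrite xF xG.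
Qed.

Lemma edge_nonempty (T : finType) (r : rel T) F : F \in edges r -> exists x, x \in F.
Proof. by case/edgeP=> x [y [_ ->]]; exists x; rewrite set21. Qed.

(** * Extending uniquely restricted matchings *)

Lemma nu_witness (T : finType) (r : rel T) :
  exists2 M, uniquely_restricted r M & #|M| = nu_ur r.
Proof.
have ur0 : uniquely_restricted r set0.
  rewrite /uniquely_restricted /matching sub0set.
  rewrite (_ : trivIset set0); last by apply/trivIsetP=> A B; rewrite inE.
  apply/forallP=> M; apply/implyP=> /andP[/andP[/subsetP sM _] /eqP cM].
  apply/eqP/setP=> F; rewrite inE; apply/negP=> FM.
  have [x xF] := edge_nonempty (sM F FM).
  have: x \in cover M by apply/bigcupP; exists F.
  by rewrite cM /cover big_set0 inE.
have := @eq_bigmax_cond _ [pred M | uniquely_restricted r M]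
  (fun M : {set {set T}} => #|M|).
case; first by apply/card_gt0P; exists set0.
by move=> M urM E; exists M => //; rewrite -E.
Qed.

Lemma cover_set1U (T : finType) (F : {set T}) (M : {set {set T}}) :
  cover (F |: M) = F :|: cover M.
Proof. by rewrite /cover bigcup_setU big_set1. Qed.

Lemma cover_edges (T : finType) (r : rel T) (M : {set {set T}}) x :
  M \subset edges r -> x \in cover M -> exists y, r x y \/ r y x.
Proof.
move=> /subsetP sM /bigcupP[F /sM/edgeP[a [b [rab ->]]]].
by rewrite !inE => /orP[]/eqP->; [exists b; left | exists a; right].
Qed.

(** The engine of all lower bounds. A uniquely restricted matching of the
    smaller graph extends by [uv] as soon as every matching of [r] that covers
    the enlarged vertex set is forced to use [uv]: what such a matching does
    elsewhere then lives in the smaller graph and covers the old vertex set. *)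
Lemma nu_forced (T : finType) (r : rel T) (D : {set T}) u v :
  r u v -> u \in D -> v \in D ->
  (forall M N, matching (delete r D) M -> matching r N ->
     cover N = [set u; v] :|: cover M -> [set u; v] \in N) ->
  nu_ur (delete r D) < nu_ur r.
Proof.
move=> ruv uD vD forced.
have [M /andP[mM /forallP urM] <-] := nu_witness (delete r D).
have [sM tM] := andP mM.
have cMD x : x \in cover M -> x \notin D.
  by move/(cover_edges sM)=> [y [] /and3P[]].
have dis F : F \in M -> [disjoint [set u; v] & F].
  move=> FM; rewrite disjoint_subset; apply/subsetP=> x xuv; rewrite inE.
  apply/negP=> xF; have /cMD : x \in cover M by apply/bigcupP; exists F.
  by move: xuv; rewrite !inE => /orP[]/eqP->; rewrite ?uD ?vD.
have M0 : set0 \notin M.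
  by apply/negP=> /(subsetP sM)/edge_nonempty[x]; rewrite inE.
have [tM1 uvM] := trivIsetU1 dis tM M0.
have mM1 : matching r ([set u; v] |: M).
  rewrite /matching tM1 andbT; apply/subsetP=> F.
  rewrite in_setU1 => /orP[/eqP->|/(subsetP sM)]; first exact: edge_mem.
  by case/edgeP=> a [b [/deleteW rab ->]]; apply: edge_mem.
have -> : #|M|.+1 = #|[set u; v] |: M| by rewrite cardsU1 uvM.
apply: (@leq_bigmax_cond _ _ (fun M : {set {set T}} => #|M|)).
rewrite /uniquely_restricted mM1 /=; apply/forallP=> N.
apply/implyP=> /andP[mN /eqP]; rewrite cover_set1U => cN.
have uvN := forced _ _ mM mN cN.
have [sN tN] := andP mN.
have N'uv F x : F \in N :\ [set u; v] -> x \in F -> x \notin [set u; v].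
  rewrite in_setD1 => /andP[nF FN] xF; apply/negP=> xuv.
  by move/eqP: nF; apply; apply: (trivIset_meet tN FN uvN xF).
have cN' : cover (N :\ [set u; v]) = cover M.
  move: cN; rewrite -{1}(setD1K uvN) cover_set1U => /setP cN.
  apply/setP=> z; move: (cN z); rewrite !(in_setU z [set u; v]).
  have [xuv _|nz] := boolP (z \in [set u; v]); last by [].
  transitivity false; last symmetry; apply/negP.
    by case/bigcupP=> F FN' /(N'uv _ _ FN'); rewrite xuv.
  move/cMD; move: xuv; rewrite !inE => /orP[]/eqP->; by rewrite ?uD ?vD.
have mN' : matching (delete r D) (N :\ [set u; v]).
  apply/andP; split; last exact: trivIsetS (subD1set _ _) tN.
  apply/subsetP=> F FN'.
  have Fout : forall z, z \in F -> z \notin D.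
    by move=> z zF; apply/cMD; rewrite -cN'; apply/bigcupP; exists F.
  have /(subsetP sN)/edgeP[a [b [rab FE]]] : F \in N by case/setD1P: FN'.
  by apply/edgeP; exists a, b; rewrite /delete rab !Fout // FE ?set21 ?set22.
have := urM (N :\ [set u; v]); rewrite mN' cN' eqxx /= => /eqP <-.
by rewrite setD1K.
Qed.

(** After deleting all neighbours of [u], the vertex [v] is the only possible
    partner of [u], so [uv] is forced. *)
Lemma nu_closed_nbrs (T : finType) (r : rel T) u v :
  symmetric r -> irreflexive r -> r u v ->
  nu_ur (delete r (closed_nbrs r u)) < nu_ur r.
Proof.
move=> rs ri ruv.
apply: (@nu_forced _ _ _ u v) => //; rewrite ?setU11 ?in_setU1 ?inE ?ruv ?orbT //.
move=> M N /andP[sM _] /andP[sN _] cN.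
have /bigcupP[F FN uF] : u \in cover N by rewrite cN !inE eqxx.
have [t rut FE] : exists2 t, r u t & F = [set u; t].
  have /edgeP[a [b [rab FE]]] := subsetP sN _ FN.
  move: uF; rewrite FE !inE => /orP[]/eqP E; first by exists b; rewrite ?E.
  by exists a; rewrite ?E 1?rs // setUC.
have: t \in cover N by apply/bigcupP; exists F; rewrite // FE set22.
rewrite cN !inE => /orP[/orP[]/eqP tE|].
- by move: rut; rewrite tE ri.
- by rewrite -tE -FE.
have tD : t \in closed_nbrs r u by rewrite !inE rut orbT.
by case/(cover_edges sM)=> y [] /and3P[]; rewrite tD.
Qed.

(** If no matching edge leaves [A], the covered part of [A] is a union of
    disjoint pairs. *)
Lemma even_cover (T : finType) (r : rel T) (A : {set T}) (N : {set {set T}}) :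
  irreflexive r -> matching r N ->
  (forall a b, r a b -> [set a; b] \in N -> (a \in A) = (b \in A)) ->
  ~~ odd #|A :&: cover N|.
Proof.
move=> ri /andP[/subsetP sN tN] NA.
set P := [set F in N | F \subset A].
have PN : P \subset N by apply/subsetP=> F; rewrite inE => /andP[].
have -> : A :&: cover N = cover P.
  apply/setP=> x; apply/setIP/bigcupP.
    case=> xA /bigcupP[F FN xF]; exists F => //; rewrite inE FN /=.
    have /edgeP[a [b [rab FE]]] := sN F FN; rewrite FE in FN xF *.
    have NAab := NA _ _ rab FN; rewrite subUset !sub1set.
    by case/set2P: xF xA NAab => -> -> // ->.
  case=> F; rewrite inE => /andP[FN /subsetP FA] xF; split; first exact: FA.
  by apply/bigcupP; exists F.
have /eqP <- := trivIsetS PN tN.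
rewrite (eq_bigr (fun=> 2)) ?sum_nat_const ?oddM ?andbF // => F.
move/(subsetP PN)/sN/edgeP=> [a [b [rab ->]]]; rewrite cards2.
by case: eqP rab => // ->; rewrite ri.
Qed.

Lemma side_cut (T : finType) (r : rel T) x y a b :
  a \in side r x y -> cut r x y a b -> b \in side r x y.
Proof. by rewrite !inE => xa /connect1; apply: connect_trans. Qed.

Lemma side_root (T : finType) (r : rel T) x y : x \in side r x y.
Proof. by rewrite inE. Qed.

(** A bridge between deleted vertices is forced by parity: on the side of [u],
    an odd number of vertices is to be covered, and the bridge is the only
    edge that leaves this side. In contrast with [nu_closed_nbrs], the other
    neighbours of [u] and [v] survive, which makes this step much cheaper. *)
Lemma nu_bridge (T : finType) (r : rel T) u v :
  symmetric r -> irreflexive r -> r u v -> v \notin side r u v ->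
  nu_ur (delete r [set u; v]) < nu_ur r.
Proof.
move=> rs ri ruv vS; apply: (@nu_forced _ _ _ u v); rewrite ?set21 ?set22 //.
move=> M N mM mN cN; apply: contraT => uvN.
have sideE a b : cut r u v a b -> (a \in side r u v) = (b \in side r u v).
  by move=> c; apply/idP/idP => /side_cut; apply; rewrite // cut_sym.
have eN : ~~ odd #|side r u v :&: cover N|.
  apply: (even_cover ri mN) => a b rab abN; apply: sideE; rewrite /cut rab /=.
  by apply: contraNneq uvN => <-.
have outM a b : delete r [set u; v] a b ->
    (a \in side r u v) = (b \in side r u v).
  case/and3P=> rab auv _; apply: sideE; rewrite /cut rab /=.
  by apply: contraNneq auv => <-; rewrite set21.
have eM : ~~ odd #|side r u v :&: cover M|.
  by apply: (@even_cover _ (delete r [set u; v])) => [||a b /outM] //; apply: delete_irr.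
have cE : side r u v :&: cover N = u |: (side r u v :&: cover M).
  rewrite cN; apply/setP=> x; rewrite in_setI !in_setU !in_set1 in_setI.
  have [->|_] := eqVneq x u; first by rewrite side_root.
  by have [->|_] := eqVneq x v; [rewrite (negbTE vS) | ].
move: eN; rewrite cE cardsU1 oddD (negbTE eM) addbF in_setI.
have -> : u \in cover M = false => /=; last by rewrite andbF.
apply/negP; have [sM _] := andP mM.
by case/(cover_edges sM)=> y [] /and3P[_]; rewrite !inE eqxx ?orbT.
Qed.

(** * Deficient graphs and separating edges *)

Definition stars (T : finType) (r : rel T) (A : {set T}) : {set {set T}} :=
  \bigcup_(x in A) star r x.

(** The working form of a good bridge [xy]: removing it leaves a vertex of
    degree at most 2 on either side. Unlike the existence of a path between
    two such vertices, this form visibly survives deletions. *)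
Definition separating (T : finType) (r : rel T) (x y : T) : bool :=
  [&& r x y, y \notin side r x y,
      [exists z, (z \in side r x y) && (degree r z <= 2)]
    & [exists z, (z \in side r y x) && (degree r z <= 2)]].

Definition separating_edges (T : finType) (r : rel T) : {set {set T}} :=
  [set [set x; y] | x in T, y in T & separating r x y].

(** The class on which the greedy deletions run. It is closed under deleting
    vertices, and a connected cubic graph enters it with the first deletion. *)
Definition deficient (T : finType) (r : rel T) : Prop :=
  [/\ symmetric r, irreflexive r, subcubic r
    & forall x, exists2 y, connect r x y & degree r y <= 2].

Lemma connect_invariant (T : finType) (r : rel T) (P : T -> Prop) x y :
  P x -> (forall a b, P a -> r a b -> P b) -> connect r x y -> P y.
Proof.
move=> Px Pr /connectP[p]; elim: p x Px => [|z p IH] x Px /=; first by move=> _ ->.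
by case/andP=> /(Pr _ _ Px); apply: IH.
Qed.

(** A vertex whose degree drops when passing from [r] to [r'] ends with degree
    at most 2. So if the [c']-component of [x] had no vertex of degree at most
    2, none of its vertices would have lost an edge, and it would be all of the
    [c]-component, which contains [y]. The relations [c] and [c'] are [r] and [r'] themselves, or
    [r] and [r'] without a given bridge. *)
Lemma low_degree_transfer (T : finType) (r r' c c' : rel T) x y :
  subcubic r -> subrel r' r -> subrel c r ->
  (forall a b, c a b -> r' a b -> c' a b) ->
  connect c x y -> degree r' y <= 2 ->
  exists2 z, connect c' x z & degree r' z <= 2.
Proof.
move=> r3 sr' sc cc' xy ylow; apply: contrapT => none.
have full z t : connect c' x z -> r z t -> r' z t.
  move=> xz rzt; have z3 : 2 < degree r' z.
    by rewrite ltnNge; apply/negP=> zlow; apply: none; exists z.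
  have /eqP E : nbrs r' z == nbrs r z.
    rewrite eqEcard (leq_trans (r3 z) z3) andbT.
    by apply/subsetP=> s; rewrite !inE; apply: sr'.
  by have := rzt; rewrite -(in_set (r z)) -/(nbrs r z) -E inE.
apply: none; exists y => //.
apply: (connect_invariant (P := fun z => connect c' x z)) xy => // a b xa cab.
by apply: (connect_trans xa) (connect1 _); apply: cc' (full _ _ xa (sc _ _ cab)).
Qed.

Lemma deficient_delete (T : finType) (r : rel T) (D : {set T}) :
  symmetric r -> irreflexive r -> subcubic r ->
  (forall x, exists2 y, connect r x y & degree (delete r D) y <= 2) ->
  deficient (delete r D).
Proof.
move=> rs ri r3 low; split; [exact: delete_sym|exact: delete_irr| |].
  by move=> x; apply: leq_trans (r3 x); apply/degree_sub/deleteW.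
move=> x; have [y xy ylow] := low x.
by apply: (low_degree_transfer r3 _ _ _ xy ylow) => //; apply: deleteW.
Qed.

Lemma deficient_deleteW (T : finType) (r : rel T) (D : {set T}) :
  deficient r -> deficient (delete r D).
Proof.
case=> rs ri r3 low; apply: deficient_delete => // x.
have [y xy ylow] := low x; exists y => //.
by apply: leq_trans ylow; apply/degree_sub/deleteW.
Qed.

Lemma cut_connectC (T : finType) (r : rel T) x y :
  symmetric r -> connect_sym (cut r x y).
Proof. by move=> rs; apply/sym_connect_sym/cut_sym. Qed.

Lemma separatingC (T : finType) (r : rel T) x y :
  symmetric r -> separating r x y -> separating r y x.
Proof.
move=> rs /and4P[rxy xy lx ly]; apply/and4P; split=> //; first by rewrite rs.
by rewrite inE cutC cut_connectC // inE in xy *.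
Qed.

Lemma separating_edgeP (T : finType) (r : rel T) (F : {set T}) :
  reflect (exists x y, separating r x y /\ F = [set x; y])
          (F \in separating_edges r).
Proof. exact: (@edgeP _ (separating r)). Qed.

Lemma separating_edges_sub (T : finType) (r : rel T) :
  separating_edges r \subset edges r.
Proof.
apply/subsetP=> F /separating_edgeP[x [y [/and4P[rxy _ _ _] ->]]].
exact: edge_mem.
Qed.

Lemma connect_mono (T : finType) (c c' : rel T) x y :
  subrel c c' -> connect c x y -> connect c' x y.
Proof. by move=> s; apply: connect_sub x y => a b /s/connect1. Qed.

(** Deleting vertices can only help a surviving good bridge: either a side
    loses nothing, or some vertex of what remains of it has lost an edge. *)
Lemma separating_delete (T : finType) (r : rel T) (D : {set T}) x y :
  subcubic r -> x \notin D -> y \notin D ->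
  separating r x y -> separating (delete r D) x y.
Proof.
move=> r3 xD yD /and4P[rxy xy].
have low a b : [exists z, (z \in side r a b) && (degree r z <= 2)] ->
    [exists z, (z \in side (delete r D) a b) && (degree (delete r D) z <= 2)].
  case/existsP=> z /andP[]; rewrite inE => az zlow.
  have [||||||t at_ tlow] := @low_degree_transfer _ r (delete r D) (cut r a b)
    (cut (delete r D) a b) a z.
  - exact: r3.
  - exact: deleteW.
  - by move=> ? ? /andP[].
  - by move=> s t /andP[_ st] r'st; apply/andP.
  - exact: az.
  - by apply: leq_trans zlow; apply/degree_sub/deleteW.
  by apply/existsP; exists t; rewrite inE at_.
move=> /low lx /low ly; apply/and4P; split=> //; first by rewrite /delete rxy xD.
apply: contra xy; rewrite !inE; apply: connect_mono => a b /andP[/deleteW ab abxy].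
exact/andP.
Qed.

Lemma separating_edges_delete (T : finType) (r : rel T) (D : {set T}) (L : {set {set T}}) :
  symmetric r -> subcubic r ->
  (forall d t, d \in D -> separating r d t -> [set d; t] \in L) ->
  separating_edges r \subset separating_edges (delete r D) :|: L.
Proof.
move=> rs r3 DL; apply/subsetP=> F /separating_edgeP[x [y [sxy ->]]].
rewrite in_setU; have [xD|xD] := boolP (x \in D); first by rewrite DL ?orbT.
have [yD|yD] := boolP (y \in D); first by rewrite setUC DL ?orbT //; apply: separatingC.
apply/orP; left; apply/separating_edgeP; exists x, y; split=> //.
exact: separating_delete.
Qed.

(** * Counting the edges destroyed by a deletion *)

Lemma edges_delete (T : finType) (r : rel T) (D : {set T}) (K : {set {set T}}) :
  symmetric r -> (forall d t, d \in D -> r d t -> [set d; t] \in K) ->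
  edges r \subset edges (delete r D) :|: K.
Proof.
move=> rs DK; apply/subsetP=> F /edgeP[x [y [rxy ->]]].
rewrite in_setU; have [xD|xD] := boolP (x \in D); first by rewrite DK ?orbT.
have [yD|yD] := boolP (y \in D); first by rewrite setUC DK ?orbT // rs.
by rewrite edge_mem // /delete rxy xD.
Qed.

Lemma card_le_setU (T : finType) (A B C : {set T}) :
  A \subset B :|: C -> #|A| <= #|B| + #|C|.
Proof.
move/subset_leq_card/leq_trans; apply.
by rewrite cardsU leq_subr.
Qed.

Lemma edges_delete_lt (T : finType) (r : rel T) (D : {set T}) x y :
  r x y -> x \in D -> #|edges (delete r D)| < #|edges r|.
Proof.
move=> rxy xD; apply/proper_card/properP; split.
  by apply/subsetP=> F /edgeP[a [b [/deleteW rab ->]]]; apply: edge_mem.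
exists [set x; y]; first exact: edge_mem.
apply/edgeP=> -[a [b [/and3P[_ aD bD]]]].
by case/set2_eq=> -[E _]; rewrite E ?(negbTE aD) ?(negbTE bD) in xD.
Qed.

Lemma stars_mem (T : finType) (r : rel T) (A : {set T}) x y :
  x \in A -> r x y -> [set x; y] \in stars r A.
Proof. by move=> xA rxy; apply/bigcupP; exists x => //; apply: star_mem. Qed.

Lemma card_stars (T : finType) (r : rel T) (A : {set T}) :
  subcubic r -> #|stars r A| <= 3 * #|A|.
Proof.
move=> r3; rewrite mulnC -sum_nat_const /stars.
elim/big_rec2: _ => [|x n B _ leBn]; first by rewrite cards0.
apply: leq_trans (leq_add (leq_trans (card_star r x) (r3 x)) leBn).
by rewrite cardsU leq_subr.
Qed.

(** An edge inside [A] belongs to two of the stars. *)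
Lemma card_stars_edge (T : finType) (r : rel T) (A : {set T}) x y :
  symmetric r -> irreflexive r -> subcubic r ->
  r x y -> x \in A -> y \in A -> #|stars r A| < 3 * #|A|.
Proof.
move=> rs ri r3 rxy xA yA.
have yx : y != x by apply: contraTneq rxy => ->; rewrite ri.
have E : stars r A = star r x :|: stars r (A :\ x).
  by rewrite /stars (bigD1 x xA) /=; congr (_ :|: _); apply: eq_bigl => z;
    rewrite !inE andbC.
have : 0 < #|star r x :&: stars r (A :\ x)|.
  apply/card_gt0P; exists [set x; y].
  apply/setIP; split; first exact: star_mem.
  by rewrite (setUC [set x]); apply: stars_mem; [rewrite !inE yx | rewrite rs].
have := leq_trans (card_star r x) (r3 x).
have := card_stars (A :\ x) r3.
have := cardsD1 x A; rewrite xA E cardsU; lia.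
Qed.

(** The edges at [u] are already counted at the neighbours of [u]. *)
Lemma closed_nbrs_cover (T : finType) (r : rel T) u d t :
  symmetric r -> d \in closed_nbrs r u -> r d t ->
  [set d; t] \in stars r (nbrs r u).
Proof.
move=> rs /setU1P[->|du] rdt; last exact: stars_mem.
by rewrite setUC; apply: stars_mem; rewrite ?inE // rs.
Qed.

(** * The bound for graphs without cubic components *)

(** Good bridges cut the graph into a tree of pieces, and a smallest side is a
    leaf of this tree: another good bridge starting inside the side of [x]
    would have one of its own sides strictly inside, away from [x]. *)
Lemma separating_side_min (T : finType) (r : rel T) x y :
  symmetric r -> separating r x y ->
  (forall a b, separating r a b -> #|side r x y| <= #|side r a b|) ->
  forall a b, a \in side r x y -> separating r a b -> [set a; b] = [set x; y].
Proof.
move=> rs /and4P[rxy yS _ _] min a b aS sab.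
apply/eqP; apply: contraT => ne.
have smaller c d : separating r c d -> [set c; d] != [set x; y] ->
    c \in side r x y -> x \notin side r c d -> False.
  move=> scd ne' cS xcd; have := min _ _ scd; apply/negP; rewrite -ltnNge.
  rewrite (cardsD1 x (side r x y)) side_root ltnS; apply/subset_leq_card/subsetP.
  move=> z; rewrite [z \in side r c d]inE => cz.
  suff [zS zcd] : z \in side r x y /\ z \in side r c d.
    by rewrite in_setD1 zS andbT; apply: contraNneq xcd => <-.
  move: cz; apply: (connect_invariant (P := fun z => z \in side r x y /\ z \in side r c d)).
    by split=> //; apply: side_root.
  move=> s t [sS scd'] st; have tcd := side_cut scd' st; split=> //.
  apply: (side_cut sS); have /andP[rst _] := st; rewrite /cut rst /=.
  apply: contraNneq xcd => /set2_eq[[<- _]|[sy _]] //.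
  by rewrite sy (negbTE yS) in sS.
have bS : b \in side r x y.
  by apply: side_cut aS _; rewrite /cut ne andbT; case/and4P: sab.
have [xab|xab] := boolP (x \in side r a b); last by case: (smaller a b).
case: (smaller b a) => //; first exact: separatingC; first by rewrite setUC.
have /and4P[_ + _ _] := sab; apply: contra => xba.
rewrite inE in xab; rewrite inE cutC cut_connectC // in xba.
by rewrite inE (connect_trans xab) // cutC.
Qed.

(** One step of the induction. [K] and [L] bound the edges and the good bridges
    destroyed by the deletion of [D], which gains [k] matching edges; the
    deletion is affordable when it destroys at most 6 of them per gained
    edge. *)
Lemma deletion_bound (T : finType) (r : rel T) (D : {set T})
    (K L : {set {set T}}) k :
  symmetric r -> subcubic r ->
  (forall d t, d \in D -> r d t -> [set d; t] \in K) ->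
  (forall d t, d \in D -> separating r d t -> [set d; t] \in L) ->
  #|K| + #|L| <= 6 * k -> nu_ur (delete r D) + k <= nu_ur r ->
  #|edges (delete r D)| + #|separating_edges (delete r D)|
    <= 6 * nu_ur (delete r D) ->
  #|edges r| + #|separating_edges r| <= 6 * nu_ur r.
Proof.
move=> rs r3 DK DL KL nuD IH.
have := card_le_setU (edges_delete rs DK).
have := card_le_setU (separating_edges_delete rs r3 DL).
lia.
Qed.

Lemma degree_gt0 (T : finType) (r : rel T) x y : r x y -> 0 < degree r x.
Proof. by move=> rxy; apply/card_gt0P; exists y; rewrite inE. Qed.

Lemma degree_gt0P (T : finType) (r : rel T) x : 0 < degree r x -> exists y, r x y.
Proof. by case/card_gt0P=> y; rewrite inE; exists y. Qed.

Lemma connect_degree_gt0 (T : finType) (r : rel T) x y :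
  symmetric r -> connect r x y -> 0 < degree r x -> 0 < degree r y.
Proof.
move=> rs xy x0.
apply: (connect_invariant (P := fun z => is_true (0 < degree r z))) xy => //.
by move=> a b _ rab; apply: (@degree_gt0 _ _ _ a); rewrite rs.
Qed.

Lemma degree2_other (T : finType) (r : rel T) u v :
  degree r u = 2 -> r u v ->
  exists w, [/\ r u w, w != v & forall t, r u t -> t = v \/ t = w].
Proof.
move=> u2 ruv; have : 0 < #|nbrs r u :\ v|.
  by have := cardsD1 v (nbrs r u); rewrite inE ruv [#|nbrs r u|]u2; lia.
case/card_gt0P=> w; rewrite !inE => /andP[wv ruw]; exists w; split=> // t rut.
have [->|tv] := eqVneq t v; [by left | right].
have /eqP/cards1P[s E] : #|nbrs r u :\ v| = 1.
  by have := cardsD1 v (nbrs r u); rewrite inE ruv [#|nbrs r u|]u2; lia.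
have : t \in nbrs r u :\ v by rewrite !inE tv.
have : w \in nbrs r u :\ v by rewrite !inE wv.
by rewrite E !inE => /eqP-> /eqP->.
Qed.

Lemma card_set2_le (T : finType) (x y : T) : #|[set x; y]| <= 2.
Proof. by rewrite cards2; case: eqP. Qed.

Lemma card_set3_le (T : finType) (x y z : T) : #|[set x; y; z]| <= 3.
Proof.
by have := card_set2_le x y; have := cardsU [set x; y] [set z]; rewrite cards1; lia.
Qed.

(** A vertex of degree at most 2 lets us delete its closed neighbourhood at the
    price of 6 edges, so only the good bridges met by this deletion are a
    problem. Leaves are harmless, since they destroy 3 edges, which cannot
    contribute more than 6. Otherwise one works at a leaf [S] of the tree of
    good bridges, where [xy] is the only good bridge and [u] has degree 2:

    - if [u] is [x], its second edge [xt] is a bridge too, though not a good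
      one; matching it destroys 5 edges and one good bridge;
    - if [u] is not adjacent to [x], its closed neighbourhood meets no good
      bridge;
    - if [u] is adjacent to [x], matching the bridge [xy] turns [u] into a leaf
      attached to its other neighbour [w], and [uw] is matched next; together
      this destroys 8 edges, and only the 3 edges at [y] can be good bridges,
      which fits into the budget of 12. *)
Lemma deficient_bound (T : finType) (r : rel T) :
  deficient r -> #|edges r| + #|separating_edges r| <= 6 * nu_ur r.
Proof.
have [n] := ubnP #|edges r|; elim: n r => // n IHn r; rewrite ltnS => le_n def.
have [rs ri r3 low] := def.
have IH (D : {set T}) x y : x \in D -> r x y ->
    #|edges (delete r D)| + #|separating_edges (delete r D)|
      <= 6 * nu_ur (delete r D).
  move=> xD rxy; apply: IHn; last exact: deficient_deleteW.
  exact: leq_trans (edges_delete_lt rxy xD) le_n.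
have [E0|] := eqVneq (edges r) set0.
  have := subset_leq_card (separating_edges_sub r); rewrite E0 cards0; lia.
case/set0Pn=> F0 /edgeP[x0 [y0 [rx0y0 _]]] {F0}.
have del_nbrs u (L : {set {set T}}) : 0 < degree r u ->
    (forall d t, d \in closed_nbrs r u -> separating r d t -> [set d; t] \in L) ->
    3 * degree r u + #|L| <= 6 -> #|edges r| + #|separating_edges r| <= 6 * nu_ur r.
  case/degree_gt0P=> v ruv uL le6.
  apply: (@deletion_bound _ r (closed_nbrs r u) (stars r (nbrs r u)) L 1) => //.
  - by move=> d t; apply: closed_nbrs_cover.
  - exact: leq_trans (leq_add (card_stars _ r3) (leqnn _)) le6.
  - by rewrite addn1; apply: nu_closed_nbrs ruv.
  - by apply: (IH _ u v) => //; rewrite setU11.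
have [/existsP[u /eqP u1]|/existsPn no_leaf] := boolP [exists u, degree r u == 1].
  apply: (del_nbrs u (stars r (nbrs r u))); rewrite ?u1 //.
    by move=> d t du /and4P[rdt _ _ _]; apply: closed_nbrs_cover.
  by have := card_stars (nbrs r u) r3; rewrite [#|nbrs _ _|]u1; lia.
have deg2 u : 0 < degree r u -> degree r u <= 2 -> degree r u = 2.
  by have := no_leaf u; lia.
have [/existsP[xy0 sxy0]|none] := boolP [exists p, separating r p.1 p.2]; last first.
  have [u x0u ulow] := low x0.
  have u2 : degree r u = 2.
    by apply: deg2 => //; apply: connect_degree_gt0 x0u (degree_gt0 rx0y0).
  apply: (del_nbrs u set0); rewrite ?u2 ?cards0 // => d t _ sdt.
  by case/existsP: none; exists (d, t).
case: (@arg_minnP _ xy0 (fun p => separating r p.1 p.2)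
  (fun p => #|side r p.1 p.2|) sxy0) => -[x y] /= sxy min.
have {min sxy0 xy0} only := separating_side_min rs sxy (fun a b => min (a, b)).
have /and4P[rxy yS /existsP[u /andP[uS ulow]] _] := sxy.
have notyS t : t \in side r x y -> t != y by apply: contraTneq => ->.
have nbrS d t : d \in side r x y -> r d t -> [set d; t] != [set x; y] ->
    t \in side r x y.
  by move=> dS rdt ne; apply: side_cut dS _; rewrite /cut rdt.
have uNS t : u != x -> r u t -> t \in side r x y.
  move=> ux rut; apply: (nbrS _ _ uS rut); apply/eqP=> /set2_eq[[E _]|[E _]].
    by rewrite E eqxx in ux.
  by have := notyS u uS; rewrite E eqxx.
have u2 : degree r u = 2.
  apply: deg2 => //; have [->|ux] := eqVneq u x; first exact: degree_gt0 rxy.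
  apply: (@connect_degree_gt0 _ r x) (degree_gt0 rxy) => //.
  by move: uS; rewrite inE; apply: connect_mono => a b /andP[].
have [ux|ux] := eqVneq u x.
  subst u.
  have [t [rxt ty xNt]] := degree2_other u2 rxy.
  have tS : t \in side r x y.
    apply: (nbrS _ _ (side_root r x y) rxt); apply/eqP=> /set2_eq[[_ E]|[E _]].
      by rewrite E eqxx in ty.
    by have := notyS x (side_root _ _ _); rewrite E eqxx.
  (* Without [xt], only the bridge [xy] leaves [x], so one reaches nothing
     but [x] and the far side of [xy]. *)
  have tbr : t \notin side r x t.
    apply/negP; rewrite inE => xt.
    suff [tx|] : t = x \/ t \in side r y x.
    - by move: rxt; rewrite tx ri.
    - move=> yt; move/negP: yS; apply; rewrite inE in tS.
      rewrite inE (connect_trans tS) //.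
      by rewrite cut_connectC // cutC -[connect _ _ _]inE.
    move: xt; apply: (connect_invariant (P := fun z => z = x \/ z \in side r y x)).
      by left.
    move=> a b [->|aS] /andP[rab ne].
      have [->|bt] := xNt b rab; first by right; apply: side_root.
      by rewrite bt eqxx in ne.
    have [E|ne'] := eqVneq [set a; b] [set y; x].
      case/set2_eq: E => -[Ea Eb]; first by left.
      by right; rewrite Eb side_root.
    by right; apply: side_cut aS _; apply/andP.
  apply: (@deletion_bound _ r [set x; t] (stars r [set x; t])
    [set [set x; y]] 1) => //.
  - by move=> d s; apply: stars_mem.
  - move=> d s dxt sds; rewrite inE; apply/eqP; apply: only sds.
    by case/set2P: dxt => -> //; apply: side_root.
  - rewrite cards1 addn1.
    apply: leq_trans (card_stars_edge rs ri r3 rxt (set21 x t) (set22 x t)) _.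
    exact: leq_mul (leqnn 3) (card_set2_le x t).
  - by rewrite addn1; apply: nu_bridge.
  - by apply: (IH _ x y) => //; rewrite set21.
have [rux|nux] := boolP (r u x); last first.
  apply: (del_nbrs u set0); rewrite ?u2 ?cards0 // => d t /setU1P du sdt.
  have dS : d \in side r x y by case: du => [->|] //; rewrite inE; apply: uNS.
  have [[Ed _]|[Ed _]] := set2_eq (only _ _ dS sdt).
    by case: du; rewrite ?inE Ed => E; [rewrite -E eqxx in ux | rewrite E in nux].
  by have := notyS _ dS; rewrite Ed eqxx.
have [w [ruw wx uNw]] := degree2_other u2 rux.
have wS : w \in side r x y by apply: uNS.
have wy := notyS _ wS.
have uy := notyS _ uS.
have le12 : #|stars r [set x; y; w]| + #|star r y| <= 12.
  have xA : x \in [set x; y; w] by rewrite !inE eqxx.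
  have yA : y \in [set x; y; w] by rewrite !inE eqxx orbT.
  apply: (@leq_trans (8 + 3)) => //; apply: leq_add.
    rewrite -ltnS; apply: leq_trans (card_stars_edge rs ri r3 rxy xA yA) _.
    exact: leq_mul (leqnn 3) (card_set3_le x y w).
  exact: leq_trans (card_star r y) (r3 y).
set r1 := delete r [set x; y].
have r1uw : r1 u w by rewrite /r1 /delete ruw !inE !negb_or ux uy wx wy.
have E1 : closed_nbrs r1 u = [set u; w].
  apply/setP=> t; rewrite !inE; congr (_ || _); apply/idP/eqP=> [|-> //].
  case/and3P=> /uNw[->|//] _; by rewrite !inE eqxx.
have rD : delete r1 [set u; w] = delete r ([set x; y] :|: [set u; w]).
  exact: delete_delete.
(* The star of [u] is missing from the count because its edges [ux] and [uw]
   lie in the stars of [x] and [w]. *)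
apply: (@deletion_bound _ r ([set x; y] :|: [set u; w]) (stars r [set x; y; w])
    (star r y) 2) => //.
- move=> d t; rewrite in_setU => /orP[dxy rdt|/set2P[->|-> rwt]].
  + by apply: stars_mem; rewrite // in_setU dxy.
  + by case/uNw=> ->; rewrite setUC; apply: stars_mem;
      rewrite 1?rs // !inE eqxx ?orbT.
  + by apply: stars_mem; rewrite // !inE eqxx orbT.
- move=> d t dD sdt; have yx : [set x; y] \in star r y.
    by rewrite setUC star_mem // rs.
  have [dy|dy] := eqVneq d y.
    by rewrite dy star_mem // -dy; case/and4P: sdt.
  rewrite (only d t) //; case/setUP: dD => /set2P[] E; subst d => //.
  + exact: side_root.
  + by rewrite eqxx in dy.
- rewrite -rD -E1.
  rewrite addn2; apply: (@leq_trans (nu_ur r1).+1); last exact: nu_bridge.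
  by rewrite ltnS; apply: nu_closed_nbrs r1uw; [apply: delete_sym|apply: delete_irr].
- by apply: (IH _ x y) => //; rewrite !inE eqxx.
Qed.

(** * A strict bound for graphs without 4-cycles *)

Lemma nbrs_deletion (T : finType) (r : rel T) u :
  symmetric r -> irreflexive r -> subcubic r -> 0 < degree r u ->
  #|edges r| <= #|edges (delete r (closed_nbrs r u))| + 3 * degree r u
  /\ nu_ur (delete r (closed_nbrs r u)) < nu_ur r.
Proof.
move=> rs ri r3 /degree_gt0P[v ruv]; split; last exact: nu_closed_nbrs ruv.
have cover d t := @closed_nbrs_cover _ r u d t rs.
apply: leq_trans (card_le_setU (edges_delete rs cover)) _.
by rewrite leq_add2l; apply: card_stars.
Qed.

Lemma nbrs_deletion_edge (T : finType) (r : rel T) u v w :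
  symmetric r -> irreflexive r -> subcubic r -> r u v -> r u w -> r v w ->
  #|edges r| < #|edges (delete r (closed_nbrs r u))| + 3 * degree r u.
Proof.
move=> rs ri r3 ruv ruw rvw.
have cover d t := @closed_nbrs_cover _ r u d t rs.
apply: leq_ltn_trans (card_le_setU (edges_delete rs cover)) _.
by rewrite ltn_add2l; apply: card_stars_edge rvw _ _; rewrite ?inE.
Qed.

Lemma edges_bound (T : finType) (r : rel T) :
  deficient r -> #|edges r| <= 6 * nu_ur r.
Proof. by move/deficient_bound; apply: leq_trans; apply: leq_addr. Qed.

(** Deleting a leaf and its neighbour destroys only 3 edges. *)
Lemma leaf_bound (T : finType) (r : rel T) u :
  deficient r -> degree r u = 1 -> #|edges r| + 3 <= 6 * nu_ur r.
Proof.
move=> def u1; have [rs ri r3 _] := def.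
have [] := @nbrs_deletion _ r u rs ri r3; first by rewrite u1.
rewrite u1; have := edges_bound (deficient_deleteW (closed_nbrs r u) def).
by move: #|_| #|_| => e1 e2; lia.
Qed.

Lemma other_nbr (T : finType) (r : rel T) x y :
  r x y -> degree r x != 1 -> exists2 z, r x z & z != y.
Proof.
move=> rxy x1; have /card_gt0P[z] : 0 < #|nbrs r x :\ y|.
  have := cardsD1 y (nbrs r x); rewrite inE rxy [#|nbrs r x|](erefl (degree r x)).
  by have := degree_gt0 rxy; move: #|_| x1 => k; lia.
by rewrite !inE => /andP[zy rxz]; exists z.
Qed.

Definition C4_free (T : finType) (r : rel T) : Prop :=
  forall x y, x != y -> #|nbrs r x :&: nbrs r y| <= 1.

Lemma C4_free_delete (T : finType) (r : rel T) (D : {set T}) :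
  C4_free r -> C4_free (delete r D).
Proof.
move=> free x y xy; apply: leq_trans (free x y xy).
by apply/subset_leq_card/subsetP=> z; rewrite !inE => /andP[/deleteW-> /deleteW->].
Qed.

Lemma C4_free_uniq (T : finType) (r : rel T) x y v w :
  C4_free r -> x != y -> r x v -> r y v -> r x w -> r y w -> v = w.
Proof.
move=> free xy xv yv xw yw; apply/eqP; apply: contraT => vw.
have: 1 < #|nbrs r x :&: nbrs r y|; last by rewrite ltnNge free.
have <- : #|[set v; w]| = 2 by rewrite cards2 vw.
by apply/subset_leq_card/subsetP=> z /set2P[]->; rewrite !inE ?xv ?yv ?xw ?yw.
Qed.

Lemma edges_gt0P (T : finType) (r : rel T) :
  reflect (exists x y, r x y) (0 < #|edges r|).
Proof.
apply: (iffP card_gt0P) => [[F /edgeP[x [y [rxy _]]]]|[x [y rxy]]].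
  by exists x, y.
by exists [set x; y]; apply: edge_mem.
Qed.

(** Six times the matching number equals the number of edges for K_{2,3}, and
    4-cycles are the only obstacle to strictness: without leaves, the last deletion that destroys an edge
    takes a vertex [u] of degree 2 with all edges at its two neighbours. If it
    destroyed 6 edges, these neighbours would have a second common
    neighbour. *)
Lemma C4_free_bound (T : finType) (r : rel T) :
  deficient r -> C4_free r -> 0 < #|edges r| -> #|edges r| < 6 * nu_ur r.
Proof.
have [n] := ubnP #|edges r|; elim: n r => // n IHn r.
rewrite ltnS => le_n def free /edges_gt0P[x0 [y0 rx0y0]].
have [rs ri r3 low] := def.
have [/existsP[u /eqP u1]|/existsPn no_leaf] := boolP [exists u, degree r u == 1].
  by have := leaf_bound def u1; move: #|_| => e; lia.
(* Starting from the end [x0] of an edge keeps [u] from being isolated. *)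
have [u x0u ulow] := low x0.
have u0 : 0 < degree r u by apply: connect_degree_gt0 x0u (degree_gt0 rx0y0).
have [v ruv] := degree_gt0P u0.
have [le6 lt_nu] := nbrs_deletion rs ri r3 u0.
have def' := deficient_deleteW (closed_nbrs r u) def.
have [/IHn IH|] := boolP (0 < #|edges (delete r (closed_nbrs r u))|).
  have {}IH : #|edges (delete r (closed_nbrs r u))|
      < 6 * nu_ur (delete r (closed_nbrs r u)).
    apply: IH => //; last exact: C4_free_delete.
    by apply: leq_trans (edges_delete_lt ruv _) le_n; rewrite setU11.
  by move: #|_| #|_| IH le6 => e1 e2; lia.
move/edges_gt0P=> none; have le5 := edges_bound def'.
suff lt6 : #|edges r| < #|edges (delete r (closed_nbrs r u))| + 3 * degree r u.
  by move: #|_| #|_| le5 lt6 => e1 e2; lia.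
have [v1 rvv1 v1u] : exists2 z, r v z & z != u by apply: other_nbr; rewrite // rs.
have [ruv1|nuv1] := boolP (r u v1); first exact: nbrs_deletion_edge rvv1.
have [z rv1z zv] : exists2 z, r v1 z & z != v by apply: other_nbr; rewrite // rs.
have [/setU1P[zu|]|zD] := boolP (z \in closed_nbrs r u).
- by rewrite rs -zu rv1z in nuv1.
- rewrite inE => ruz; case/eqP: zv; rewrite eq_sym in v1u.
  by apply: (C4_free_uniq free v1u) => //; rewrite rs.
- case: none; exists v1, z; rewrite /delete rv1z zD andbT /=.
  by rewrite !inE negb_or v1u.
Qed.

(** * Cubic graphs *)

(** Double counting of the incident pairs of a vertex and an edge. *)
Lemma handshake (T : finType) (r : rel T) :
  symmetric r -> irreflexive r -> \sum_x degree r x = 2 * #|edges r|.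
Proof.
move=> rs ri; transitivity (\sum_x \sum_(F in edges r | x \in F) 1).
  apply: eq_bigr => x _; rewrite sum1_card.
  rewrite -[degree r x](@card_in_imset _ _ (fun y => [set x; y])); last first.
    by move=> y z _ _ /set2_eq[[]|[-> ->]].
  apply: eq_card => F; apply/imsetP/andP.
    by case=> y; rewrite inE => rxy ->; rewrite edge_mem // set21.
  case=> /edgeP[a [b [rab ->]]] /set2P[]E; subst x.
    by exists b; rewrite ?inE.
  by exists a; rewrite ?inE 1?rs // setUC.
rewrite -(exchange_big_dep xpredT) //= mulnC -sum_nat_const.
apply: eq_bigr => F /edgeP[x [y [rxy ->]]]; rewrite sum1_card cards2.
by case: eqP rxy => // ->; rewrite ri.
Qed.

(** When two vertices with two common neighbours always have three, the
    vertices with the neighbourhood [A] of [a] form a set [B] of size 3, and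
    the vertices of [A] in turn all have neighbourhood [B]. By connectivity
    nothing else remains. *)
Lemma K33_twins (T : finType) (r : rel T) a c :
  symmetric r -> irreflexive r -> connected_graph r ->
  (forall x, degree r x = 3) ->
  (forall x y, x != y -> 1 < #|nbrs r x :&: nbrs r y| ->
     #|nbrs r x :&: nbrs r y| = 3) ->
  a != c -> 1 < #|nbrs r a :&: nbrs r c| -> isomorphic r K33.
Proof.
move=> rs ri conn r3 twins ac ac1.
have twinE x y : x != y -> 1 < #|nbrs r x :&: nbrs r y| -> nbrs r x = nbrs r y.
  move=> xy xy1; have I3 := twins x y xy xy1.
  have /eqP E1 : nbrs r x :&: nbrs r y == nbrs r x.
    by rewrite eqEcard subsetIl I3 [#|nbrs r x|]r3.
  have /eqP E2 : nbrs r x :&: nbrs r y == nbrs r y.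
    by rewrite eqEcard subsetIr I3 [#|nbrs r y|]r3.
  by rewrite -E1 E2.
have acE := twinE a c ac ac1.
pose A := nbrs r a.
have [v vA] : exists v, v \in A by apply/card_gt0P; rewrite [#|A|]r3.
pose B := nbrs r v.
have nA x : x \in A -> nbrs r x = B.
  move=> xA; have [-> //|xv] := eqVneq x v.
  apply: twinE => //; have <- : #|[set a; c]| = 2 by rewrite cards2 ac.
  have cA z : z \in A -> r z c by rewrite /A acE inE rs.
  have aA z : z \in A -> r z a by rewrite /A inE rs.
  by apply/subset_leq_card/subsetP=> z /set2P[]->; rewrite !inE ?cA ?aA.
have nB x : x \in B -> nbrs r x = A.
  move=> xB; apply/esym/eqP; rewrite eqEcard [#|A|]r3 [#|nbrs r x|]r3 leqnn andbT.
  by apply/subsetP=> z /nA zB; rewrite inE rs -(in_set (r z)) -/(nbrs r z) zB.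
have AB x : x \notin A -> x \in B.
  have: x \in A \/ x \in B; last by case=> [->|].
  apply: (connect_invariant (P := fun z => z \in A \/ z \in B)) (conn a x).
    by right; rewrite inE rs -(in_set (r a)).
  move=> y z [/nA|/nB] yE ryz; [right|left]; by rewrite -yE inE.
have nAB x : x \in A -> x \notin B.
  move=> xA; apply/negP=> xB; have := nA x xA; rewrite (nB x xB) => E.
  by have := ri x; rewrite -(in_set (r x)) -/(nbrs r x) (nB x xB) xA.
have A3 : #|A| = 3 by apply: r3.
have B3 : #|B| = 3 by apply: r3.
pose C x := if x \in A then A else B.
have xC x : x \in C x by rewrite /C; case: ifPn => // /AB.
have C3 x : #|C x| = 3 by rewrite /C; case: ifP.
pose f x : bool * 'I_3 := (x \in A, inord (index x (enum (C x)))).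
exists f; split.
  apply: inj_card_bij.
    move=> x y [Exy /(congr1 val)] /=.
    have CE : C x = C y by rewrite /C Exy.
    have lt3 z : index z (enum (C z)) < 3 by rewrite -(C3 z) cardE index_mem mem_enum.
    rewrite !inordK // CE => E.
    have xe : x \in enum (C y) by rewrite mem_enum -CE.
    have ye : y \in enum (C y) by rewrite mem_enum.
    by rewrite -(nth_index x xe) E nth_index.
  rewrite card_prod card_bool card_ord -cardsT.
  have -> : [set: T] = A :|: B.
    apply/setP=> x; rewrite in_setT in_setU.
    by have [//|/AB->] := boolP (x \in A).
  rewrite cardsU A3 B3; suff -> : A :&: B = set0 by rewrite cards0.
  by apply/setP=> x; rewrite in_setI in_set0; apply/negP=> /andP[/nAB/negP].
move=> x y; rewrite /K33 /=; rewrite -[RHS](in_set (r x)) -/(nbrs r x).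
have [xA|/AB xB] := boolP (x \in A).
  rewrite nA //; have [/nAB/negbTE-> //|/AB->] := boolP (y \in A); by [].
by rewrite nB //; case: (y \in A).
Qed.

(** The first deletion destroys 9 edges instead of 6. As the number of edges of
    a cubic graph is a multiple of 3, it suffices to save a single edge at any
    later point, or already in this deletion. A triangle through the deleted
    vertex saves one. Two vertices with exactly two common neighbours save
    three: after deleting around one of them, the other is a leaf. If neither
    occurs, the graph is K_{3,3}, or it has no 4-cycle and [C4_free_bound]
    saves one. *)
Lemma cubic_bound (T : finType) (r : rel T) :
  symmetric r -> irreflexive r -> connected_graph r ->
  (forall x, degree r x = 3) -> ~ isomorphic r K33 -> #|edges r| <= 6 * nu_ur r.
Proof.
move=> rs ri conn deg3 notK33.
have r3 : subcubic r by move=> x; rewrite deg3.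
have [k ek] : exists k, #|edges r| = 3 * k.
  have := handshake rs ri; rewrite (eq_bigr (fun=> 3)) ?sum_nat_const //.
  by move: #|edges r| #|_| => e n En; exists (e %/ 3); lia.
have [->//|/set0Pn[F /edgeP[x0 [_ _]]]] := eqVneq (edges r) set0.
  by rewrite cards0.
have step u : [/\ #|edges r| <= #|edges (delete r (closed_nbrs r u))| + 9,
    nu_ur (delete r (closed_nbrs r u)) < nu_ur r
    & deficient (delete r (closed_nbrs r u))].
  have [] := @nbrs_deletion _ r u rs ri r3; rewrite deg3 //; split=> //.
  apply: deficient_delete => // x; exists u => //.
  rewrite (_ : degree _ u = 0) //; apply/eqP; rewrite cards_eq0; apply/eqP/setP=> z.
  by rewrite !inE /delete setU11 andbF.
have gain u : #|edges r| < #|edges (delete r (closed_nbrs r u))| + 9 ->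
    #|edges r| <= 6 * nu_ur r.
  have [_ lt_nu /edges_bound le6] := step u.
  by move: #|edges (delete _ _)| le6 => e; rewrite ek; lia.
have [/existsP[u /existsP[v /existsP[w]]]|none] :=
    boolP [exists u, exists v, exists w, [&& r u v, r u w & r v w]].
  case/and3P=> uv uw vw; apply: (gain u).
  by have := nbrs_deletion_edge rs ri r3 uv uw vw; rewrite deg3.
have no_tri u v w : r u v -> r u w -> ~~ r v w.
  move=> uv uw; apply: contra none => vw; apply/existsP; exists u.
  by apply/existsP; exists v; apply/existsP; exists w; rewrite uv uw.
have [/existsP[a /existsP[c /andP[ac /eqP ac2]]]|no2] :=
    boolP [exists a, exists c, (a != c) && (#|nbrs r a :&: nbrs r c| == 2)].
  have [v] : exists v, v \in nbrs r a :&: nbrs r c by apply/card_gt0P; rewrite ac2.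
  rewrite !inE => /andP[rav rcv].
  have nac : ~~ r a c by rewrite rs; apply: (no_tri v); rewrite rs.
  have [le9 lt_nu def'] := step a.
  have c1 : degree (delete r (closed_nbrs r a)) c = 1.
    transitivity #|nbrs r c :\: nbrs r a|.
      apply: eq_card => z; rewrite !inE /delete !inE negb_or eq_sym (negbTE ac).
      rewrite nac /= negb_or; have [->|] := eqVneq z a => /=; last by rewrite andbC.
      by rewrite andbF rs (negbTE nac) andbF.
    by rewrite cardsD setIC ac2 [#|nbrs r c|]deg3.
  have := leaf_bound def' c1; move: #|_| #|_| le9 => e1 e2; lia.
have common x y : x != y -> 1 < #|nbrs r x :&: nbrs r y| ->
    #|nbrs r x :&: nbrs r y| = 3.
  move=> xy gt1; have : #|nbrs r x :&: nbrs r y| <= 3.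
    by rewrite -(deg3 x); apply/subset_leq_card/subsetIl.
  have : #|nbrs r x :&: nbrs r y| != 2.
    apply: contra no2 => E; apply/existsP; exists x; apply/existsP; exists y.
    by rewrite xy.
  by move: #|_| gt1 => n; lia.
have free : C4_free r.
  move=> x y xy; rewrite leqNgt; apply/negP=> gt1; apply: notK33.
  exact: (K33_twins rs ri conn deg3 common xy gt1).
have [le9 lt_nu def'] := step x0.
suff /(C4_free_bound def' (C4_free_delete _ free)) lt6 :
    0 < #|edges (delete r (closed_nbrs r x0))|.
  by move: #|edges (delete _ _)| le9 lt6 => e; rewrite ek; lia.
have [v rv] : exists v, r x0 v by apply: degree_gt0P; rewrite deg3.
have [t rvt tx0] : exists2 t, r v t & t != x0.
  by apply: other_nbr; rewrite ?deg3 // rs.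
have x0t : ~~ r x0 t by apply: (no_tri v); rewrite // rs.
have [z] : exists z, z \in nbrs r t :\: nbrs r x0.
  apply/card_gt0P; rewrite cardsD [#|nbrs r t|]deg3 subn_gt0.
  exact: leq_ltn_trans (free _ _ tx0) _.
rewrite !inE => /andP[x0z rtz]; apply/edges_gt0P; exists t, z.
have zx0 : z != x0 by apply: contraNneq x0t => <-; rewrite rs.
by rewrite /delete rtz !inE !negb_or tx0 x0t x0z zx0.
Qed.

(** * From good bridges to separating edges *)

Lemma walk_edges_split (T : finType) (x : T) p F :
  F \in walk_edges x p ->
  exists p1 v p2, p = p1 ++ v :: p2 /\ F = [set last x p1; v].
Proof.
elim: p x => [//|y p IH] x; rewrite /walk_edges /= in_cons => /orP[/eqP->|].
  by exists [::], y, p.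
by case/IH=> [p1 [v [p2 [-> ->]]]]; exists (y :: p1), v, p2.
Qed.

Lemma walk_edges_last (T : finType) (x y : T) p :
  [set last x p; y] \in walk_edges x (rcons p y).
Proof.
rewrite /walk_edges; elim: p x => [|z p IH] x /=; first exact: mem_head.
by rewrite in_cons IH orbT.
Qed.

Lemma path_cut (T : finType) (r : rel T) u v x p :
  path r x p -> v \notin x :: p -> path (cut r u v) x p.
Proof.
elim: p x => [//|y p IH] x /= /andP[rxy rp].
rewrite in_cons negb_or => /andP[vx vyp]; rewrite IH // andbT /cut rxy /=.
apply: contra vyp => /eqP/setP/(_ v); rewrite !inE eqxx orbT (negbTE vx) /=.
by move=> ->.
Qed.

Lemma bridge_side (T : finType) (r : rel T) u v :
  symmetric r -> irreflexive r -> r u v -> bridge r [set u; v] ->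
  v \notin side r u v.
Proof.
move=> rs ri ruv [_ nocycle]; apply/negP; rewrite inE => /connectP[p0 cp0 last0].
case/shortenP: cp0 last0 => p cp up _ vE.
apply: nocycle; exists u, p; split.
- rewrite /ucycle /= rcons_path -vE rs ruv andbT; apply/andP; split=> //.
  by apply: sub_path cp => a b /andP[].
- case: p cp up vE => [_ _ vE|w [|w' p]] //=; first by rewrite vE ri in ruv.
  by rewrite /cut => /andP[/andP[_ ne] _] _ vE; rewrite vE eqxx in ne.
- by rewrite vE setUC; apply: walk_edges_last.
Qed.

(** The path witnessing that [F] is good visits each vertex once, so the two
    parts into which [F] splits it both avoid [F]. *)
Lemma good_bridge_separating (T : finType) (r : rel T) (F : {set T}) :
  symmetric r -> irreflexive r -> good_bridge r F -> F \in separating_edges r.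
Proof.
move=> rs ri [brF [x [p [rp up Fp lx ly]]]].
have [p1 [v [p2 [pE FE]]]] := walk_edges_split Fp.
move: rp up ly; rewrite pE -cat_cons cat_uniq cat_path last_cat.
set u := last x p1; case/andP=> rp1 /andP[ruv rp2] /and3P[_ dis _] ly.
rewrite FE -/u in brF *.
have v1 : v \notin x :: p1.
  by apply: contra dis => vp1; apply/hasP; exists v; rewrite // mem_head.
have u2 : u \notin v :: p2.
  apply: contra dis => up; apply/hasP; exists u => //; exact: mem_last.
apply/separating_edgeP; exists u, v; split=> //; apply/and4P; split=> //.
- exact: bridge_side.
- apply/existsP; exists x; rewrite lx inE cut_connectC // andbT.
  by apply/connectP; exists p1; rewrite // path_cut.
- apply/existsP; exists (last v p2); rewrite ly inE andbT.
  by apply/connectP; exists p2; rewrite // path_cut.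
Qed.

Lemma nu_ur_bound (T : finType) (r : rel T) :
  symmetric r -> irreflexive r -> connected_graph r -> subcubic r ->
  ~ isomorphic r K33 -> #|edges r| + #|good_bridges r| <= 6 * nu_ur r.
Proof.
move=> rs ri conn r3 notK33.
have sep : #|good_bridges r| <= #|separating_edges r|.
  apply/subset_leq_card/subsetP=> F; rewrite inE => /asboolP.
  exact: good_bridge_separating.
apply: leq_trans (leq_add (leqnn _) sep) _.
have [/existsP[z zlow]|/existsPn high] := boolP [exists z, degree r z <= 2].
  by apply: deficient_bound; split=> // x; exists z.
have -> : separating_edges r = set0.
  apply/setP=> F; rewrite [RHS]inE; apply/negP=> /separating_edgeP[x [y [sxy _]]].
  have /and4P[_ _ /existsP[z /andP[_ zlow]] _] := sxy.
  by have := high z; rewrite zlow.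
rewrite cards0 addn0; apply: cubic_bound => // x.
by apply/eqP; rewrite eqn_leq r3 ltnNge high.
Qed.

Import Order.TTheory GRing.Theory Num.Theory.
Local Open Scope ring_scope.

Theorem theorem3 (T : finType) (e : rel T)
    (e_sym : symmetric e) (e_irr : irreflexive e)
    (e_connected : connected_graph e) (e_subcubic : subcubic e)
    (e_not_K33 : ~ isomorphic e K33) :
  (#|edges e|%:R + #|good_bridges e|%:R) / 6%:R <= (nu_ur e)%:R :> rat.
Proof.
rewrite ler_pdivrMr ?ltr0n // -natrD -natrM ler_nat mulnC.
exact: nu_ur_bound.
Qed.
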